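(* Let $K$ be a division ring, $S$ an automorphism of $K$, $D$ an $S$-derivation of $K$ and $R=K[t;S,D]$. Let $A\in M_n(K)$ and let $\{e_1,\dots,e_r\}$ be a complete set of invariant factors of $A$, with $e_r$ the last one. Let $\Delta(e_r):=\{f\in R: f\sim e_r\}$. For $\beta\in K$ the following are equivalent: (i) $\beta\in\operatorname{rspec}(A)$. (ii) There exists $\gamma\in K\setminus\{0\}$ such that $\beta^\gamma\in V(e_r)$. (iii) There exists $e_r'\in\Delta(e_r)$ such that $\beta\in V(e_r')$. Similarly, for $\alpha\in K$ the following are equivalent: (i') $\alpha\in\operatorname{lspec}(A)$; (ii') there exists $\gamma\in K\setminus\{0\}$ such that $\alpha^\gamma\in V'(e_r)$; (iii') there exists $e_r'\in\Delta(e_r)$ such that $\alpha\in V'(e_r')$.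
   Context: An $S$-derivation is an additive map $D:K\to K$ with $D(ab)=S(a)D(b)+D(a)b$. $R=K[t;S,D]$ is the Ore ring of skew polynomials $\sum a_it^i$ ($a_i\in K$) with $ta=S(a)t+D(a)$. For $f\in R$: $V(f)=\{a\in K: f\in R(t-a)\}$ and $V'(f)=\{a\in K: f\in (t-a)R\}$. For $a\in K$, $c\in K\setminus\{0\}$: $a^c:=S(c)ac^{-1}+D(c)c^{-1}$. For $f,g\in R$, $f\sim g$ (similar) means $R/Rf\cong R/Rg$ as left $R$-modules. $S,D$ are extended entrywise to rows, columns and matrices. $K^n$ is the set of rows and ${}^nK$ the set of columns. For $A\in M_n(K)$ define $T_A:K^n\to K^n$, $T_A(v)=S(v)A+D(v)$, and $L_A:{}^nK\to{}^nK$, $L_A(u)=A\,S^{-1}(u)-D(S^{-1}(u))$. $\alpha\in K$ is a left eigenvalue of $A$ if $T_A(v)=\alpha v$ for some nonzero $v\in K^n$; $\beta\in K$ is a right eigenvalue of $A$ if $L_A(u)=u\beta$ for some nonzero $u\in{}^nK$. $\operatorname{lspec}(A)$ and $\operatorname{rspec}(A)$ are the sets of left and right eigenvalues. Invariant factors: since $S$ is an automorphism, $R$ is a left and right principal ideal domain. For $f,g\in R$, $f$ strongly divides $g$ ($f\,||\,g$) if there is $c\in R$ with $cR=Rc$, $c\in fR$ and $g\in cR$. There are $P,Q\in GL_n(R)$ with $P(tI-A)Q$ diagonal, with each diagonal entry strongly dividing the next. The nonunit diagonal entries, listed in order and reindexed as $e_1,\dots,e_r$ (so $e_1\,||\cdots||\,e_r$),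 are the invariant factors of $A$ (determined up to similarity), and $e_r$ is the last one. *)

(* Defs.v *)
From HB Require Import structures.
From mathcomp Require Import all_boot all_algebra ring_quotient generic_quotient.
From mathcomp Require Import boolp classical_sets.
Set Implicit Arguments.
Unset Strict Implicit.
Unset Printing Implicit Defensive.
Import GRing.Theory.
Local Open Scope ring_scope.
Local Open Scope classical_set_scope.

Definition division_ring (K : unitRingType) : Prop :=
  forall x : K, x != 0 -> x \is a GRing.unit.

Record skew_derivation (K : nzRingType) (S : {rmorphism K -> K}) :=
  SkewDerivation {
    skew_der :> {additive K -> K};
    skew_derM : forall a b : K,
      skew_der (a * b) = S a * skew_der b + skew_der a * b }.

(* The Ore ring K[t; S, D]. As a left K-module it is that of the polynomials,
   p representing the sum of the p`_i t^i; the product is the one forced by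
   t a = S(a) t + D(a). *)
Definition ore (K : nzRingType) (S : {rmorphism K -> K})
  (D : skew_derivation S) : Type := {poly K}.

Section OreRing.
Variables (K : nzRingType) (S : {rmorphism K -> K}) (D : skew_derivation S).
Implicit Types (a : K) (f g h : {poly K}).

(* Left multiplication by t, written in the polynomial ring. *)
Definition ore_tmul g : {poly K} := map_poly S g * 'X + map_poly D g.

Definition ore_mul f g : {poly K} := \sum_(i < size f) f`_i *: iter i ore_tmul g.

Local Notation T := ore_tmul.

Fact coef_tmul g i :
  (T g)`_i = (if i == 0%N then 0 else S g`_i.-1) + D g`_i.
Proof. by rewrite /ore_tmul coefD coefMX !coef_map_id0 ?raddf0 //; case: i. Qed.

Fact tmulD g h : T (g + h) = T g + T h.
Proof.
apply/polyP=> i; rewrite !(coefD, coef_tmul) !raddfD /=.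
by case: eqP => _; rewrite ?add0r // addrACA.
Qed.

Fact tmul0 : T 0 = 0.
Proof. by apply: (addrI (T 0)); rewrite -tmulD !addr0. Qed.

Fact tmulZ a h : T (a *: h) = S a *: T h + D a *: h.
Proof.
apply/polyP=> i; rewrite !(coefD, coefZ, coef_tmul) skew_derM.
by case: eqP => _; rewrite ?add0r // rmorphM /= mulrDr addrA.
Qed.

Fact itmulD i g h : iter i T (g + h) = iter i T g + iter i T h.
Proof. by elim: i => //= i ->; rewrite tmulD. Qed.

Fact tmul_sum n (F : 'I_n -> {poly K}) : T (\sum_i F i) = \sum_i T (F i).
Proof. exact: (big_morph T tmulD tmul0). Qed.

Fact ore_mul_wide n f g : (size f <= n)%N ->
  ore_mul f g = \sum_(i < n) f`_i *: iter i T g.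
Proof.
move=> le_fn; rewrite /ore_mul (big_ord_widen n (fun i => f`_i *: iter i T g)) //.
rewrite big_mkcond; apply: eq_bigr => i _; case: ltnP => // le_fi.
by rewrite nth_default // scale0r.
Qed.

Fact ore_mulDl : left_distributive ore_mul +%R.
Proof.
move=> f g h; pose n := maxn (size f) (size g).
rewrite !(@ore_mul_wide n) ?leq_maxl ?leq_maxr ?size_polyD //.
by rewrite -big_split; apply: eq_bigr => i _; rewrite coefD scalerDl.
Qed.

Fact ore_mulDr : right_distributive ore_mul +%R.
Proof.
move=> f g h; rewrite /ore_mul -big_split; apply: eq_bigr => i _ /=.
by rewrite [iter _ _ _]itmulD scalerDr.
Qed.

Fact ore_mul0r g : ore_mul 0 g = 0.
Proof. by rewrite /ore_mul size_poly0 big_ord0. Qed.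

Fact ore_mulZl a f g : ore_mul (a *: f) g = a *: ore_mul f g.
Proof.
rewrite (@ore_mul_wide (size f)) ?size_scale_leq // scaler_sumr.
by apply: eq_bigr => i _; rewrite coefZ scalerA.
Qed.

Fact ore_mulX f g : ore_mul (f * 'X) g = ore_mul f (T g).
Proof.
rewrite (@ore_mul_wide (size f).+1); last first.
  by apply: leq_trans (size_polyMleq _ _) _; rewrite size_polyX addn2.
rewrite big_ord_recl coefMX scale0r add0r; apply: eq_bigr => i _.
by rewrite coefMX lift0 iterSr.
Qed.

Fact ore_tmul_mul f g : ore_mul (T f) g = T (ore_mul f g).
Proof.
rewrite {1}/ore_tmul ore_mulDl ore_mulX.
rewrite !(@ore_mul_wide (size f)) ?size_poly // -big_split tmul_sum.
apply: eq_bigr => i _; rewrite tmulZ !coef_map_id0 ?raddf0 //=.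
by rewrite -iterSr.
Qed.

Fact ore_mulA : associative ore_mul.
Proof.
move=> f g h; rewrite {1}/ore_mul {3}/ore_mul.
rewrite (big_morph (ore_mul^~ h) (fun x y => ore_mulDl x y h) (ore_mul0r h)).
apply: eq_bigr => i _; rewrite ore_mulZl; congr (_ *: _).
by elim: (nat_of_ord i) => //= j ->; rewrite [RHS]ore_tmul_mul.
Qed.

Fact ore_mul1r : left_id 1 ore_mul.
Proof. by move=> g; rewrite /ore_mul size_poly1 big_ord1 coef1 scale1r. Qed.

Fact skew_der1 : D 1 = 0.
Proof.
have := skew_derM D 1 1; rewrite rmorph1 !(mul1r, mulr1) => D1.
by apply: (addrI (D 1)); rewrite addr0.
Qed.

Fact tmulXn (i : nat) : T ('X^i) = 'X^(i.+1).
Proof.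
apply/polyP=> k; rewrite coef_tmul !coefXn.
have -> (b : bool) : D b%:R = 0 by case: b; rewrite ?skew_der1 ?raddf0.
by case: k => [|k]; rewrite addr0 //= rmorph_nat.
Qed.

Fact ore_mulr1 : right_id 1 ore_mul.
Proof.
move=> f; rewrite /ore_mul -[RHS]coefK poly_def; apply: eq_bigr => i _.
by congr (_ *: _); elim: (nat_of_ord i) => //= j ->; rewrite -[RHS]tmulXn.
Qed.

Fact ore_mulXl g : ore_mul 'X g = T g.
Proof. by rewrite -['X]mul1r ore_mulX ore_mul1r. Qed.

Fact ore_mulCl a g : ore_mul a%:P g = a *: g.
Proof.
by rewrite (@ore_mul_wide 1) ?size_polyC_leq1 // big_ord1 coefC.
Qed.

HB.instance Definition _ := GRing.Zmodule.copy (ore D) {poly K}.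
HB.instance Definition _ := GRing.Zmodule_isNzRing.Build (ore D)
  ore_mulA ore_mul1r ore_mulr1 ore_mulDl ore_mulDr (@oner_neq0 {poly K}).

End OreRing.

Definition oreC (K : nzRingType) (S : {rmorphism K -> K})
  (D : skew_derivation S) (a : K) : ore D := a%:P.

Definition oreT (K : nzRingType) (S : {rmorphism K -> K})
  (D : skew_derivation S) : ore D := 'X.

Arguments oreC {K S} D a.
Arguments oreT {K S} D.

Section OreTheory.
Variables (K : nzRingType) (S : {rmorphism K -> K}) (D : skew_derivation S).

Fact oreC_zmod_morphism : zmod_morphism (oreC D).
Proof. exact: (@polyCB K). Qed.

Fact oreC_monoid_morphism : monoid_morphism (oreC D).
Proof. by split=> // a b; rewrite [RHS]ore_mulCl -mul_polyC -polyCM. Qed.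

HB.instance Definition _ :=
  GRing.isZmodMorphism.Build K (ore D) (oreC D) oreC_zmod_morphism.
HB.instance Definition _ :=
  GRing.isMonoidMorphism.Build K (ore D) (oreC D) oreC_monoid_morphism.

Lemma ore_tC (a : K) :
  oreT D * oreC D a = oreC D (S a) * oreT D + oreC D (D a).
Proof.
rewrite [oreT D * _]ore_mulXl [oreC D _ * _]ore_mulCl /ore_tmul.
by rewrite !map_polyC mul_polyC.
Qed.

Lemma oreE (f : ore D) :
  f = \sum_(i < size (f : {poly K})) oreC D (f : {poly K})`_i * oreT D ^+ i.
Proof.
have tX i : oreT D ^+ i = 'X^i :> {poly K}.
  elim: i => [|i IHi]; first by rewrite !expr0.
  by rewrite exprS IHi [LHS]ore_mulXl tmulXn.
rewrite -[LHS](coefK (f : {poly K})) poly_def.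
by apply: eq_bigr => i _; rewrite [RHS]ore_mulCl tX.
Qed.

End OreTheory.

Section Ring.
Variable R : nzRingType.
Implicit Types f g : R.

(* R f and f R. *)
Definition lprinc f : set R := [set x * f | x in [set: R]].
Definition rprinc f : set R := [set f * x | x in [set: R]].

Definition invertible f : Prop := exists g, f * g = 1 /\ g * f = 1.

(* f || g *)
Definition strongly_divides f g : Prop :=
  exists c, [/\ rprinc c = lprinc c, rprinc f c & rprinc c g].

Definition lprinc_pred f : pred R := fun x => `[< lprinc f x >].

Fact lprinc_zmod_closed f : zmod_closed (lprinc_pred f).
Proof.
split=> [|x y /asboolP[a _ <-] /asboolP[b _ <-]]; apply/asboolP.
  by exists 0; rewrite ?mul0r.
by exists (a - b); rewrite ?mulrBl.
Qed.

HB.instance Definition _ f :=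
  GRing.isZmodClosed.Build R (lprinc_pred f) (lprinc_zmod_closed f).

Definition lprinc_zmod f : zmodClosed R :=
  GRing.ZmodClosed.clone R (lprinc_pred f) _.

(* The left R-module R / R f. *)
Definition lquot f : Type := Quotient.quot (lprinc_zmod f).

HB.instance Definition _ f :=
  GRing.Zmodule.copy (lquot f) (Quotient.quot (lprinc_zmod f)).

Definition lquot_pi f (x : R) : lquot f := \pi_(lquot f)%qT x.

Definition lquot_scale f (a : R) (q : lquot f) : lquot f :=
  lquot_pi f (a * repr q).

Fact lquot_piP f x y : lquot_pi f x = lquot_pi f y <-> lprinc f (x - y).
Proof.
rewrite /lquot_pi; split=> [/eqP|fxy].
  by rewrite -Quotient.idealrBE => /asboolP.
by apply/eqP; rewrite -Quotient.idealrBE; apply/asboolP.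
Qed.

Fact lquot_piK f (q : lquot f) : lquot_pi f (repr q) = q.
Proof. exact: reprK. Qed.

Fact lquot_piD f x y : lquot_pi f (x + y) = lquot_pi f x + lquot_pi f y.
Proof. exact: (raddfD \pi_(Quotient.quot (lprinc_zmod f))%qT). Qed.

Fact lquot_scale_pi f a x : lquot_scale a (lquot_pi f x) = lquot_pi f (a * x).
Proof.
apply/lquot_piP; rewrite -mulrBr.
by have /lquot_piP[b _ <-] := lquot_piK (lquot_pi f x); exists (a * b); rewrite ?mulrA.
Qed.

Fact lquot_scaleA f a b (q : lquot f) :
  lquot_scale a (lquot_scale b q) = lquot_scale (a * b) q.
Proof. by rewrite -(lquot_piK q) !lquot_scale_pi mulrA. Qed.

Fact lquot_scale1 f : left_id 1 (@lquot_scale f).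
Proof. by move=> q; rewrite -(lquot_piK q) lquot_scale_pi mul1r. Qed.

Fact lquot_scaleDr f : right_distributive (@lquot_scale f) +%R.
Proof.
move=> a p q; rewrite -(lquot_piK p) -(lquot_piK q).
by rewrite -lquot_piD !lquot_scale_pi mulrDr lquot_piD.
Qed.

Fact lquot_scaleDl f (q : lquot f) :
  {morph (@lquot_scale f)^~ q : a b / a + b}.
Proof.
by move=> a b; rewrite -(lquot_piK q) !lquot_scale_pi mulrDl lquot_piD.
Qed.

HB.instance Definition _ f := GRing.Zmodule_isLmodule.Build R (lquot f)
  (@lquot_scaleA f) (@lquot_scale1 f) (@lquot_scaleDr f) (@lquot_scaleDl f).

Fact lquot_piZ f a x : lquot_pi f (a * x) = a *: lquot_pi f x.
Proof. by rewrite -lquot_scale_pi. Qed.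

Definition similar f g : Prop :=
  exists phi : {linear lquot f -> lquot g}, bijective phi.

Definition invertible_mx n (P : 'M[R]_n) : Prop :=
  exists Q : 'M[R]_n, P *m Q = 1%:M /\ Q *m P = 1%:M.

End Ring.

Section Evaluation.
Variables (K : unitRingType) (S : {rmorphism K -> K}) (D : skew_derivation S).
Implicit Type f : ore D.

(* V(f): the a for which t - a divides f on the right. *)
Definition right_roots f : set K := [set a | lprinc (oreT D - oreC D a) f].
(* V'(f): the a for which t - a divides f on the left. *)
Definition left_roots f : set K := [set a | rprinc (oreT D - oreC D a) f].

(* a^c, meaningful for c != 0. *)
Definition sdconj (a c : K) : K := S c * a * c^-1 + D c * c^-1.

(* Delta(f). *)
Definition simclass f : set (ore D) := [set g | similar g f].

End Evaluation.

(* row_semilin is T_A and col_semilin is L_A; Sinv stands for the inverse of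
   S, a requirement left to the statements. *)
Section Spectrum.
Variables (K : unitRingType) (S : {rmorphism K -> K}) (Sinv : K -> K).
Variables (D : skew_derivation S) (n : nat) (A : 'M[K]_n).

Definition row_semilin (v : 'rV[K]_n) : 'rV[K]_n := map_mx S v *m A + map_mx D v.

Definition col_semilin (u : 'cV[K]_n) : 'cV[K]_n :=
  A *m map_mx Sinv u - map_mx D (map_mx Sinv u).

Definition lspec : set K :=
  [set alpha | exists2 v : 'rV[K]_n, v != 0 & row_semilin v = alpha *: v].

Definition rspec : set K :=
  [set beta | exists2 u : 'cV[K]_n, u != 0 & col_semilin u = map_mx ( *%R^~ beta) u].

(* es is a complete sequence of invariant factors of A: the noninvertible
   diagonal entries, in order, of some diagonal form of t I - A. *)
Definition invariant_factors (es : seq (ore D)) : Prop :=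
  exists (P Q : 'M[ore D]_n) (d : 'rV[ore D]_n),
    [/\ invertible_mx P, invertible_mx Q,
        P *m ((oreT D)%:M - map_mx (oreC D) A) *m Q = diag_mx d,
        forall i j : 'I_n, j = i.+1 :> nat ->
          strongly_divides (d ord0 i) (d ord0 j)
      & es = [seq d ord0 i | i <- enum 'I_n & ~~ `[< invertible (d ord0 i) >]]].

End Spectrum.

Arguments right_roots {K S D} f.
Arguments left_roots {K S D} f.
Arguments sdconj {K S} D a c.
Arguments simclass {K S D} f.
Arguments row_semilin {K S} D {n} A v.
Arguments col_semilin {K S} Sinv D {n} A u.
Arguments lspec {K S} D {n} A.
Arguments rspec {K S} Sinv D {n} A.
Arguments invariant_factors {K S} D {n} A es.

(* Main.v *)
Require Import Defs.
From HB Require Import structures.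
From mathcomp Require Import all_boot all_algebra.
From mathcomp Require Import boolp classical_sets.
Set Implicit Arguments.
Unset Strict Implicit.
Unset Printing Implicit Defensive.
Import GRing.Theory.
Local Open Scope ring_scope.

(** Both eigenvalue problems are torsion problems over [R = K[t; S, D]], and
    torsion survives diagonalisation.

    For a column [c] over [K] one has
    [(t I - A) c = S(c) (t - b) - (A c - D(c) - S(c) b)],
    and the last bracket is [L_A(u) - u b] for [u = S(c)]. So [u] is a right
    eigenvector for [b] exactly when [(t I - A) c] vanishes modulo [R (t - b)].
    Since every element of [R] is congruent to a unique constant modulo
    [R (t - b)], the eigenvalue condition
    says that [t I - A] has a nonzero kernel on columns over [R / R (t - b)]
    ([rspecE]). This is unchanged when [t I - A] is multiplied by invertible
    matrices ([col_annihilated_equiv]), and for a diagonal matrix it means that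
    some entry [d] satisfies [d x] in [R (t - b)] for an [x] outside that ideal.
    Strong divisibility is two-sided divisibility because [R] is a domain
    ([strongly_divides_lprinc]), so the same [x] works for the last invariant
    factor [e] ([right_linked_last]).

    It remains to read the condition on [e], which says that there is a nonzero
    map [R / R e -> R / R (t - b)]. Taking [x] to be a nonzero constant [c], the
    identity [(t - b^c) c = S(c) (t - b)] turns it into [t - b^c] being a right
    factor of [e], that is (ii) ([right_roots_sdconj]). In that case [e c] is
    similar to [e] and is divisible by [t - b] on the right, giving (iii). From
    (iii) one returns by composing an isomorphism [R / R e = R / R e'] with the
    projection onto [R / R (t - b)] ([similar_right_linked]).

    The left half is the mirror image, with rows, [p R] in place of [R p], and
    [S(v) (t I - A) = (t - a) v - (T_A(v) - a v)]. Its matrix part is the column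
    case over the converse ring. Similarity, however, is always that of left
    modules, so the step from (iii') back needs its own argument, in which a
    relation [e' x = y e] supplies the required map of right modules
    ([similar_left_linked]). *)

(** * Principal one-sided ideals *)

Definition no_zero_divisors (R : nzRingType) : Prop :=
  forall x y : R, x * y = 0 -> x = 0 \/ y = 0.

Lemma lprincP (R : nzRingType) (f x : R) : lprinc f x <-> exists a, x = a * f.
Proof. by split=> [[a _ <-]|[a ->]]; [exists a | exists a]. Qed.

Lemma rprincP (R : nzRingType) (f x : R) : rprinc f x <-> exists a, x = f * a.
Proof. by split=> [[a _ <-]|[a ->]]; [exists a | exists a]. Qed.

Lemma lprinc_gen (R : nzRingType) (f a : R) : lprinc f (a * f).
Proof. by apply/lprincP; exists a. Qed.

Lemma rprinc_gen (R : nzRingType) (f a : R) : rprinc f (f * a).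
Proof. by apply/rprincP; exists a. Qed.

Lemma lprinc_mull (R : nzRingType) (f a x : R) : lprinc f x -> lprinc f (a * x).
Proof. by case/lprincP=> b ->; rewrite mulrA; apply: lprinc_gen. Qed.

Lemma rprinc_mulr (R : nzRingType) (f a x : R) : rprinc f x -> rprinc f (x * a).
Proof. by case/rprincP=> b ->; rewrite -mulrA; apply: rprinc_gen. Qed.

Lemma lprincD (R : nzRingType) (f x y : R) :
  lprinc f x -> lprinc f y -> lprinc f (x + y).
Proof.
by move=> /lprincP[a ->] /lprincP[b ->]; rewrite -mulrDl; apply: lprinc_gen.
Qed.

Lemma lprincB (R : nzRingType) (f x y : R) :
  lprinc f x -> lprinc f y -> lprinc f (x - y).
Proof.
by move=> /lprincP[a ->] /lprincP[b ->]; rewrite -mulrBl; apply: lprinc_gen.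
Qed.

Lemma rprincD (R : nzRingType) (f x y : R) :
  rprinc f x -> rprinc f y -> rprinc f (x + y).
Proof.
by move=> /rprincP[a ->] /rprincP[b ->]; rewrite -mulrDr; apply: rprinc_gen.
Qed.

Lemma rprincB (R : nzRingType) (f x y : R) :
  rprinc f x -> rprinc f y -> rprinc f (x - y).
Proof.
by move=> /rprincP[a ->] /rprincP[b ->]; rewrite -mulrBr; apply: rprinc_gen.
Qed.

Lemma lprinc0 (R : nzRingType) (f : R) : lprinc f 0.
Proof. by rewrite -(mul0r f); apply: lprinc_gen. Qed.

(** * Torsion modulo a principal ideal, and diagonalisation *)

Lemma lprinc_mulmx (R : nzRingType) (p : R) m n (B : 'M[R]_(m, n))
    (w : 'cV[R]_n) :
  (forall i, lprinc p (w i 0)) -> forall i, lprinc p ((B *m w) i 0).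
Proof.
move=> wp i; rewrite mxE; elim/big_ind: _ => [|x y|j _]; first exact: lprinc0.
  exact: lprincD.
exact/lprinc_mull/wp.
Qed.

Lemma rprinc_mulmx (R : nzRingType) (p : R) m n (B : 'M[R]_(m, n))
    (w : 'rV[R]_m) :
  (forall i, rprinc p (w 0 i)) -> forall i, rprinc p ((w *m B) 0 i).
Proof.
move=> wp i; rewrite mxE; elim/big_ind: _ => [|x y|j _].
- by apply/rprincP; exists 0; rewrite mulr0.
- exact: rprincD.
- exact/rprinc_mulr/wp.
Qed.

(** Left multiplication by [B] has a nonzero kernel on columns over [R / R p];
    equivalently the left module presented by [B] has a nonzero map to
    [R / R p]. Stated on representatives, so that a column over [R] may be
    changed freely modulo [R p]. *)
Definition col_annihilated (R : nzRingType) (p : R) m n (B : 'M[R]_(m, n)) :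
  Prop :=
  exists2 w : 'cV[R]_n,
    exists i, ~ lprinc p (w i 0) & forall i, lprinc p ((B *m w) i 0).

(** The mirror image: a nonzero kernel on rows over [R / p R]. *)
Definition row_annihilated (R : nzRingType) (p : R) m n (B : 'M[R]_(m, n)) :
  Prop :=
  exists2 w : 'rV[R]_m,
    exists i, ~ rprinc p (w 0 i) & forall i, rprinc p ((w *m B) 0 i).

(** The case of a 1 x 1 matrix: [x] is the image of 1 under a nonzero map
    [R / R e -> R / R p] of left modules. *)
Definition right_linked (R : nzRingType) (p e : R) : Prop :=
  exists2 x, ~ lprinc p x & lprinc p (e * x).

(** The same for a nonzero map [R / e R -> R / p R] of right modules. *)
Definition left_linked (R : nzRingType) (p e : R) : Prop :=
  exists2 x, ~ rprinc p x & rprinc p (x * e).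

(** Equivalent matrices present isomorphic modules: [w] solves [C w = 0] modulo
    [R p] exactly when [Q w] solves [B w = 0], and an invertible matrix cannot
    send a column outside [R p] into it. *)
Lemma col_annihilated_equiv (R : nzRingType) (p : R) n (P Q B C : 'M[R]_n) :
  invertible_mx P -> invertible_mx Q -> P *m B *m Q = C ->
  col_annihilated p B <-> col_annihilated p C.
Proof.
move=> [P' [PP' P'P]] [Q' [QQ' Q'Q]] <-; split=> -[w [i nwi] Bw].
  exists (Q' *m w).
    apply: contrapT => /forallNP Q'w; apply: nwi.
    rewrite -[w]mul1mx -QQ' -mulmxA; apply: lprinc_mulmx => j.
    exact: contrapT (Q'w j).
  move=> j; rewrite -mulmxA [Q *m _]mulmxA QQ' mul1mx -mulmxA.
  exact: lprinc_mulmx.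
exists (Q *m w).
  apply: contrapT => /forallNP Qw; apply: nwi.
  rewrite -[w]mul1mx -Q'Q -mulmxA; apply: lprinc_mulmx => j.
  exact: contrapT (Qw j).
have -> : B *m (Q *m w) = P' *m (P *m B *m Q *m w).
  by rewrite -!mulmxA [P' *m _]mulmxA P'P mul1mx.
exact: lprinc_mulmx.
Qed.

Lemma col_annihilated_diag (R : nzRingType) (p : R) n (d : 'rV[R]_n) :
  col_annihilated p (diag_mx d) <-> exists i, right_linked p (d 0 i).
Proof.
split=> [[w [i nwi] dw]|[i [x nx dx]]].
  by exists i, (w i 0) => //; have := dw i; rewrite mul_diag_mx mxE.
exists (\col_j (if j == i then x else 0)); first by exists i; rewrite mxE eqxx.
move=> j; rewrite mul_diag_mx !mxE; case: eqP => [->|_] //.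
by rewrite mulr0; apply: lprinc0.
Qed.

(** The content is that of [trmx_mul_rev]; what differs is the path to the
    semiring structure of [R^c], here the one inferred for a nonzero ring. *)
Lemma trmx_mul_nzrev (R : nzRingType) m n k
    (B : 'M[R]_(m, n)) (C : 'M[R]_(n, k)) :
  (B *m C)^T = (C^T : 'M[R^c]_(k, n)) *m (B^T : 'M[R^c]_(n, m))
    :> 'M[R^c]_(k, m).
Proof.
by apply/matrixP=> i j; rewrite !mxE; apply: eq_bigr => l _; rewrite !mxE.
Qed.

(** Over the converse ring [p R] becomes [R p] and rows become columns, so the
    statements about rows need no second proof. *)
Lemma row_annihilated_tr (R : nzRingType) (p : R) m n (B : 'M[R]_(m, n)) :
  row_annihilated p B <-> col_annihilated (p : R^c) (B^T : 'M[R^c]_(n, m)).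
Proof.
split=> -[w [i nwi] Bw].
  exists (w^T : 'M[R^c]_(_, _)); first by exists i; rewrite mxE.
  by move=> j; rewrite -trmx_mul_nzrev mxE; apply: Bw.
exists (w^T : 'M[R]_(_, _)); first by exists i; rewrite mxE.
by move=> j; have := Bw j; rewrite -{1}[w]trmxK -trmx_mul_nzrev mxE.
Qed.

Lemma row_annihilated_equiv (R : nzRingType) (p : R) n (P Q B C : 'M[R]_n) :
  invertible_mx P -> invertible_mx Q -> P *m B *m Q = C ->
  row_annihilated p B <-> row_annihilated p C.
Proof.
have trV (U : 'M[R]_n) : invertible_mx U -> invertible_mx (U^T : 'M[R^c]_n).
  move=> [V [UV VU]]; exists (V^T : 'M[R^c]_n).
  rewrite -!trmx_mul_nzrev UV VU.
  by split; apply/matrixP=> i j; rewrite !mxE eq_sym.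
move=> /trV vP /trV vQ <-; rewrite !row_annihilated_tr.
by apply: (col_annihilated_equiv _ vQ vP); rewrite !trmx_mul_nzrev mulmxA.
Qed.

Lemma row_annihilated_diag (R : nzRingType) (p : R) n (d : 'rV[R]_n) :
  row_annihilated p (diag_mx d) <-> exists i, left_linked p (d 0 i).
Proof.
rewrite row_annihilated_tr tr_diag_mx.
exact: (@col_annihilated_diag R^c p n d).
Qed.

(** * The last noninvertible diagonal entry *)

(** The definition of strong divisibility is one-sided, yet symmetric in a
    domain: for [c = f z] with [c R = R c], one has [c z = y c] for some [y],
    hence [c z = y f z], and cancelling [z] gives [c = y f]
    unless [z], hence [c], vanishes. *)
Lemma strongly_divides_lprinc (R : nzRingType) (dom : no_zero_divisors R)
    (f g : R) :
  strongly_divides f g -> lprinc f g.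
Proof.
move=> [c [cC /rprincP[z cz] cg]].
have {cg} /lprincP[s ->] : lprinc c g by rewrite -cC.
apply: lprinc_mull.
have /lprincP[y cyz] : lprinc c (c * z) by rewrite -cC; apply/rprincP; exists z.
have /dom[/eqP|z0] : (c - y * f) * z = 0 by rewrite mulrBl cyz -mulrA -cz subrr.
  by rewrite subr_eq0 => /eqP->; apply/lprincP; exists y.
by rewrite cz z0 mulr0; apply: lprinc0.
Qed.

Lemma strongly_divides_rprinc (R : nzRingType) (f g : R) :
  strongly_divides f g -> rprinc f g.
Proof. by move=> [c [_ fc /rprincP[h ->]]]; apply: rprinc_mulr. Qed.

Lemma last_mem (T : eqType) (x : T) (s : seq T) : s != [::] -> last x s \in s.
Proof. by case: s => // y s _; rewrite /= mem_last. Qed.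

Lemma last_nonunit (R : nzRingType) n (d : 'rV[R]_n) (rel : R -> R -> Prop) :
  (forall x, rel x x) -> (forall x y z, rel x y -> rel y z -> rel x z) ->
  (forall i j : 'I_n, j = i.+1 :> nat -> rel (d 0 i) (d 0 j)) ->
  forall i, ~ invertible (d 0 i) ->
  rel (d 0 i)
    (last 1 [seq d 0 i | i <- enum 'I_n & ~~ `[< invertible (d 0 i) >]]).
Proof.
move=> rfl tr adj i ni; set I := filter _ _.
have rel_le (k l : 'I_n) : (k <= l)%N -> rel (d 0 k) (d 0 l).
  case: l => l ltl /=; elim: l ltl => [|l IHl] ltl.
    rewrite leqn0 => /eqP k0.
    by rewrite (_ : k = Ordinal ltl) //; apply: val_inj.
  rewrite leq_eqVlt => /orP[/eqP kl|].
    by rewrite (_ : k = Ordinal ltl) //; apply: val_inj.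
  rewrite ltnS => kl; apply: tr (IHl (ltnW ltl) kl) _; exact: adj.
have iI : i \in I by rewrite mem_filter mem_enum andbT; apply/asboolPn.
have sI : sorted (fun k l : 'I_n => (k <= l)%N) I.
  apply: sorted_filter; first by move=> ? ? ?; apply: leq_trans.
  rewrite -(@sorted_map _ _ val leq) val_enum_ord; exact: iota_sorted.
have [k Ik] : exists k, I = k :: behead I by case: (I) iI => // k s; exists k.
rewrite Ik /= last_map; apply: rel_le.
have -> : last k (behead I) = nth i I (size I).-1 by rewrite nth_last Ik.
rewrite -{1}(nth_index i iI).
apply: (sorted_leq_nth _ _ _ sI); rewrite ?inE ?index_mem //.
- by move=> ? ? ?; apply: leq_trans.
- by rewrite Ik.
- by rewrite -ltnS prednK ?index_mem // Ik.
Qed.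

(** If a diagonal entry is linked to [p], so is each of its multiples by the
    same witness [x], whereas an invertible entry never is. Hence all diagonal
    entries may be replaced by the last noninvertible one; when all are
    invertible both sides fail. *)
Lemma right_linked_last (R : nzRingType) (dom : no_zero_divisors R) (p : R)
    n (d : 'rV[R]_n) :
  (forall i j : 'I_n, j = i.+1 :> nat -> strongly_divides (d 0 i) (d 0 j)) ->
  (exists i, right_linked p (d 0 i)) <->
  right_linked p
    (last 1 [seq d 0 i | i <- enum 'I_n & ~~ `[< invertible (d 0 i) >]]).
Proof.
move=> sd; set es := map _ _; split=> [[i [x nx dx]]|].
  exists x => //.
  have /lprincP[a ->] : lprinc (d 0 i) (last 1 es).
    apply: (last_nonunit (rel := fun f g => lprinc f g)).
    - by move=> f; apply/lprincP; exists 1; rewrite mul1r.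
    - by move=> f g h fg /lprincP[a ->]; apply: lprinc_mull.
    - by move=> k l /sd; apply: strongly_divides_lprinc.
    - move=> [b [_ bd]]; apply: nx.
      by rewrite -[x]mul1r -bd -mulrA; apply: lprinc_mull.
  by rewrite -mulrA; apply: lprinc_mull.
have [->|esN0] := eqVneq es [::].
  by case=> x nx; rewrite mul1r.
have /mapP[i _ ->] := last_mem 1 esN0.
by exists i.
Qed.

Lemma left_linked_last (R : nzRingType) (p : R) n (d : 'rV[R]_n) :
  (forall i j : 'I_n, j = i.+1 :> nat -> strongly_divides (d 0 i) (d 0 j)) ->
  (exists i, left_linked p (d 0 i)) <->
  left_linked p
    (last 1 [seq d 0 i | i <- enum 'I_n & ~~ `[< invertible (d 0 i) >]]).
Proof.
move=> sd; set es := map _ _; split=> [[i [x nx dx]]|].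
  exists x => //.
  have /rprincP[a ->] : rprinc (d 0 i) (last 1 es).
    apply: (last_nonunit (rel := fun f g => rprinc f g)).
    - by move=> f; apply/rprincP; exists 1; rewrite mulr1.
    - by move=> f g h fg /rprincP[a ->]; apply: rprinc_mulr.
    - by move=> k l /sd; apply: strongly_divides_rprinc.
    - move=> [b [bd _]]; apply: nx.
      by rewrite -[x]mulr1 -bd mulrA; apply: rprinc_mulr.
  by rewrite mulrA; apply: rprinc_mulr.
have [->|esN0] := eqVneq es [::].
  by case=> x nx; rewrite mulr1.
have /mapP[i _ ->] := last_mem 1 esN0.
by exists i.
Qed.

(** * Similar elements *)

Lemma lquot_pi_eq0 (R : nzRingType) (f x : R) :
  lquot_pi f x = 0 <-> lprinc f x.
Proof.
have -> : 0 = lquot_pi f 0.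
  by apply: (addrI (lquot_pi f 0)); rewrite -lquot_piD !addr0.
by rewrite lquot_piP subr0.
Qed.

(** Right multiplication by a unit carrying [R f] onto [R g] induces an
    isomorphism of the quotients. *)
Lemma similar_mulr (R : nzRingType) (f g u v : R) :
  u * v = 1 -> v * u = 1 ->
  (forall x, lprinc f x -> lprinc g (x * u)) ->
  (forall x, lprinc g x -> lprinc f (x * v)) -> Defs.similar f g.
Proof.
move=> uv vu fu gv.
pose F (q : lquot f) : lquot g := lquot_pi g (repr q * u).
have Fpi x : F (lquot_pi f x) = lquot_pi g (x * u).
  apply/lquot_piP; rewrite -mulrBl; apply: fu.
  exact/lquot_piP/lquot_piK.
pose G (q : lquot g) : lquot f := lquot_pi f (repr q * v).
have Gpi x : G (lquot_pi g x) = lquot_pi f (x * v).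
  apply/lquot_piP; rewrite -mulrBl; apply: gv.
  exact/lquot_piP/lquot_piK.
have linF : linear F.
  move=> a p q; rewrite -(lquot_piK p) -(lquot_piK q).
  by rewrite -lquot_piZ -lquot_piD !Fpi mulrDl lquot_piD -mulrA lquot_piZ.
pose FL := GRing.isLinear.Build R (lquot f) (lquot g) *:%R F linF.
pose Flin : {linear lquot f -> lquot g} := HB.pack F FL.
exists Flin; exists G => q; rewrite -(lquot_piK q).
  by rewrite /= Fpi Gpi -mulrA uv mulr1.
by rewrite Gpi /= Fpi -mulrA vu mulr1.
Qed.

(** [R / R e], isomorphic to [R / R e'], inherits the canonical surjection of
    the latter onto [R / R p]. The witness [x] represents the preimage of 1 in
    [R / R e']; it generates this module, so it is not killed in
    [R / R p]. *)
Lemma similar_right_linked (R : nzRingType) (p e e' : R) :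
  ~ lprinc p 1 -> Defs.similar e' e -> lprinc p e' -> right_linked p e.
Proof.
move=> np [phi [psi phiK psiK]] pe'.
have [x phix] : exists x, phi (lquot_pi e' x) = lquot_pi e 1.
  by exists (repr (psi (lquot_pi e 1))); rewrite lquot_piK psiK.
have [z phi1] : exists z, phi (lquot_pi e' 1) = lquot_pi e z.
  by exists (repr (phi (lquot_pi e' 1))); rewrite lquot_piK.
have e'p y : lprinc e' y -> lprinc p y.
  by case/lprincP=> a ->; apply: lprinc_mull.
exists x.
  move=> px; apply: np.
  have /lquot_piP/e'p p1zx : lquot_pi e' 1 = lquot_pi e' (z * x).
    apply: (can_inj phiK); rewrite phi1 lquot_piZ linearZ /= phix.
    by rewrite -lquot_piZ mulr1.
  by rewrite -[1](subrK (z * x)); apply: lprincD p1zx (lprinc_mull _ px).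
apply/e'p/lquot_pi_eq0; apply: (can_inj phiK).
rewrite lquot_piZ linearZ /= phix raddf0 -lquot_piZ mulr1.
by apply/lquot_pi_eq0/lprincP; exists 1; rewrite mul1r.
Qed.

(** Here an isomorphism of left modules has to yield a map of right modules.
    If it sends 1 to the class of [x], then [e' x = y e] for some [y], and with
    [e' = p g] this gives [y e = p g x], so [y] is the wanted witness. Were
    [y = p z], cancelling [p] would give [g x = z e], so [g] would lie in
    [R e' = R p g] by injectivity, and for nonzero [g] cancellation would give
    [p] a left inverse. *)
Lemma similar_left_linked (R : nzRingType) (dom : no_zero_divisors R)
    (p e e' : R) :
  p <> 0 -> ~ lprinc p 1 -> ~ rprinc p 1 ->
  Defs.similar e' e -> rprinc p e' -> left_linked p e.
Proof.
move=> pN0 np np' [phi [psi phiK psiK]] /rprincP[g def_e'].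
have [x phi1] : exists x, phi (lquot_pi e' 1) = lquot_pi e x.
  by exists (repr (phi (lquot_pi e' 1))); rewrite lquot_piK.
have phiE y : phi (lquot_pi e' y) = lquot_pi e (y * x).
  by rewrite lquot_piZ -phi1 -linearZ -lquot_piZ mulr1.
have kerE y : lprinc e (y * x) -> lprinc e' y.
  move=> /lquot_pi_eq0 yx0; apply/lquot_pi_eq0/(can_inj phiK).
  by rewrite phiE yx0 raddf0.
have [g0|gN0] := eqVneq g 0.
  (* If e' = 0 then R / R e is free on the class of x, which forces e = 0: a
     lift a of the preimage of 1 satisfies a x = 1 + b e, whence e a x lies in
     R e and e a = 0, while a = 0 would put x in R e. *)
  have e'0 : e' = 0 by rewrite def_e' g0 mulr0.
  have ker0 y : lprinc e (y * x) -> y = 0.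
    by move=> /kerE/lprincP[a ->]; rewrite e'0 mulr0.
  have [a ax1] : exists a, phi (lquot_pi e' a) = lquot_pi e 1.
    by exists (repr (psi (lquot_pi e 1))); rewrite lquot_piK psiK.
  have /lprincP[b axb] : lprinc e (a * x - 1) by apply/lquot_piP; rewrite -phiE.
  have /dom[e0|a0] : e * a = 0.
  - apply: ker0; apply/lprincP; exists (e * b + 1).
    by rewrite mulrDl -(mulrA e b) -axb mulrBr mulrA mulr1 mul1r subrK.
  - exists 1 => //; rewrite e0 mulr0.
    by apply/rprincP; exists 0; rewrite mulr0.
  have /eqP : 1 = 0 :> R.
    apply: ker0; apply/lprincP; exists (- (x * b)).
    by rewrite mul1r mulNr -mulrA -axb a0 mul0r sub0r mulrN mulr1 opprK.
  by rewrite oner_eq0.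
have /lprincP[y e'x] : lprinc e (e' * x).
  apply/lquot_pi_eq0; rewrite -phiE.
  have /lquot_pi_eq0-> : lprinc e' e' by apply/lprincP; exists 1; rewrite mul1r.
  exact: raddf0.
exists y; last by apply/rprincP; exists (g * x); rewrite -e'x def_e' mulrA.
case/rprincP=> z def_y.
have /dom[//|/eqP] : p * (g * x - z * e) = 0.
  by rewrite mulrBr !mulrA -def_e' -def_y e'x subrr.
rewrite subr_eq0 => /eqP gxe.
have /kerE/lprincP[h def_g] : lprinc e (g * x) by apply/lprincP; exists z.
have /dom[/eqP|g0] : (1 - h * p) * g = 0.
- by rewrite mulrBl mul1r -mulrA -def_e' -def_g subrr.
- by rewrite subr_eq0 => /eqP hp; apply: np; apply/lprincP; exists h.
- by rewrite g0 eqxx in gN0.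
Qed.

(** * Degrees in the Ore ring *)

Section OreDegree.
Variables (K : unitRingType) (hK : division_ring K).
Variables (S : {rmorphism K -> K}) (D : skew_derivation S).
Implicit Types (f g h : ore D) (a c : K).

Lemma division_mulf_neq0 a c : a != 0 -> c != 0 -> a * c != 0.
Proof.
by move=> /hK ua; apply: contra => /eqP ac0; rewrite -[c](mulKr ua) ac0 mulr0.
Qed.

Lemma division_rmorph_neq0 c : c != 0 -> S c != 0.
Proof.
move=> /hK uc; apply/eqP=> Sc0; have := oner_neq0 K.
by rewrite -(rmorph1 S) -(mulVr uc) rmorphM Sc0 mulr0 eqxx.
Qed.

Lemma size_iter_tmul i (g : {poly K}) :
  (size (iter i (ore_tmul D) g) <= size g + i)%N.
Proof.
elim: i => [|i IHi]; first by rewrite addn0.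
apply/leq_sizeP=> -[|j]; rewrite addnS // ltnS => le_j.
rewrite iterS coef_tmul /= !nth_default ?raddf0 ?addr0 //.
  exact: leq_trans (leqW le_j).
exact: leq_trans le_j.
Qed.

Lemma lead_iter_tmul i (g : {poly K}) :
  (iter i (ore_tmul D) g)`_(size g + i).-1 = iter i S (lead_coef g).
Proof.
have [->|gN0] := eqVneq g 0.
  rewrite lead_coef0 (_ : iter i _ 0 = 0); last first.
    by elim: i => //= i ->; rewrite tmul0.
  by rewrite coef0; elim: i => //= i <-; rewrite raddf0.
have sg : (0 < size g)%N by rewrite size_poly_gt0.
elim: i => [|i IHi]; first by rewrite addn0.
rewrite iterS coef_tmul addnS /= -{1}(prednK (ltn_addr i sg)) /= IHi.
by rewrite [X in D X]nth_default ?raddf0 ?addr0 // size_iter_tmul.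
Qed.

(** Only the top power of [t] in [f] reaches this degree, where it contributes
    the leading coefficient of [f] times an iterate of [S] applied to that of
    [g]. *)
Lemma lead_ore_mul (f g : {poly K}) : f != 0 -> g != 0 ->
  (ore_mul D f g)`_((size f).-1 + (size g).-1) != 0.
Proof.
move=> fN0 gN0.
have sf : (0 < size f)%N by rewrite size_poly_gt0.
have sg : (0 < size g)%N by rewrite size_poly_gt0.
rewrite (@ore_mul_wide _ _ _ (size f).-1.+1); last by rewrite prednK.
rewrite big_ord_recr coefD coef_sum big1 /=; last first.
  move=> i _; rewrite coefZ [X in _ * X]nth_default ?mulr0 //.
  apply: leq_trans (size_iter_tmul _ _) _.
  by rewrite -[X in (X + _)%N](prednK sg) addSnnS addnC leq_add2r.
have -> : ((size f).-1 + (size g).-1 = (size g + (size f).-1).-1)%N.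
  by rewrite -[in RHS](prednK sg) addSn /= addnC.
rewrite add0r coefZ lead_iter_tmul.
apply: division_mulf_neq0; first by rewrite lead_coef_eq0.
elim: _.-1 => /= [|i]; first by rewrite lead_coef_eq0.
exact: division_rmorph_neq0.
Qed.

Lemma ore_no_zero_divisors : no_zero_divisors (ore D).
Proof.
move=> f g fg0; have [|fN0] := eqVneq f 0; first by left.
have [|gN0] := eqVneq g 0; first by right.
by have := lead_ore_mul fN0 gN0; rewrite (fg0 : ore_mul D f g = 0) coef0 eqxx.
Qed.

End OreDegree.

(** * Reduction modulo t - a *)

Section LinearFactor.
Variables (K : unitRingType) (hK : division_ring K).
Variables (S : {rmorphism K -> K}) (D : skew_derivation S).
Implicit Types (f g h : ore D) (a c : K).

Local Notation C := (oreC D).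
Local Notation t := (oreT D).

Lemma size_linear a : size (t - C a : {poly K}) = 2.
Proof. exact: size_XsubC. Qed.

Lemma linear_neq0 a : t - C a != 0.
Proof. by rewrite -size_poly_eq0 size_linear. Qed.

Lemma lprinc_linear_const a c : lprinc (t - C a) (C c) -> c = 0.
Proof.
case/lprincP=> h def_c; have [h0|hN0] := eqVneq h 0.
  by move/eqP: def_c; rewrite h0 mul0r polyC_eq0 => /eqP.
have := lead_ore_mul hK D hN0 (linear_neq0 a).
rewrite -(def_c : _ = ore_mul D h (t - C a)).
by rewrite size_linear coefC addn1 eqxx.
Qed.

Lemma rprinc_linear_const a c : rprinc (t - C a) (C c) -> c = 0.
Proof.
case/rprincP=> h def_c; have [h0|hN0] := eqVneq h 0.
  by move/eqP: def_c; rewrite h0 mulr0 polyC_eq0 => /eqP.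
have := lead_ore_mul hK D (linear_neq0 a) hN0.
rewrite -(def_c : _ = ore_mul D (t - C a) h).
by rewrite size_linear coefC add1n eqxx.
Qed.

(** Constants represent every class of [R / R (t - a)]: the elements congruent
    to a constant form a left [K]-subspace stable under [t], because
    [t c = S(c) t + D(c)] is congruent to [S(c) a + D(c)]. *)
Lemma lprinc_linear_rem a f : exists c, lprinc (t - C a) (f - C c).
Proof.
have remT i : exists c, lprinc (t - C a) (t ^+ i - C c).
  elim: i => [|i [c cP]].
    by exists 1; rewrite expr0 rmorph1 subrr; apply: lprinc0.
  exists (S c * a + D c); have := lprincD (lprinc_mull t cP)
    (lprinc_gen (t - C a) (C (S c))).
  congr lprinc; rewrite exprS mulrBr ore_tC mulrBr rmorphD rmorphM /=.
  rewrite -addrA; congr (_ + _).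
  by rewrite [in LHS]opprD addrACA addNr add0r [in RHS]addrC opprD.
rewrite (oreE f); elim/big_ind: _ => [|x y [c xc] [c' yc]|i _].
- by exists 0; rewrite rmorph0 subrr; apply: lprinc0.
- by exists (c + c'); rewrite rmorphD opprD addrACA; apply: lprincD.
- have [c cP] := remT i; exists ((f : {poly K})`_i * c).
  by rewrite rmorphM -mulrBr; apply: lprinc_mull.
Qed.

(** On the other side a constant has to be moved past [t] from left to right,
    [b t = t S^-1(b) - D(S^-1(b))], which needs [S] to be onto. *)
Lemma rprinc_linear_rem (Sinv : K -> K) (hS' : cancel Sinv S) a f :
  exists c, rprinc (t - C a) (f - C c).
Proof.
elim/poly_ind: f => [|f c [b bP]].
  by exists 0; rewrite rmorph0 subrr; apply/rprincP; exists 0; rewrite mulr0.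
have -> : f * 'X + c%:P = (f : ore D) * t + C c :> ore D.
  congr (_ + _); rewrite -[LHS](@ore_mulr1 K S D) ore_mulX.
  by rewrite (tmulXn D 0).
exists (a * Sinv b - D (Sinv b) + c).
have bt : C b * t = (t - C a) * C (Sinv b) + C (a * Sinv b - D (Sinv b)).
  rewrite mulrBl ore_tC hS' rmorphB rmorphM /=.
  by rewrite addrA subrK addrK.
rewrite rmorphD opprD addrACA subrr addr0.
rewrite -[(f : ore D) * t](subrK (C b * t)) -mulrBl bt addrA addrK.
by apply: rprincD; [apply: rprinc_mulr | apply/rprincP; exists (C (Sinv b))].
Qed.

(** This is what the twisted conjugation [a^c] is made for. *)
Lemma sdconj_intertwine a c : c != 0 ->
  (t - C (sdconj D a c)) * C c = C (S c) * (t - C a).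
Proof.
move=> /hK uc; rewrite mulrBl ore_tC -rmorphM /sdconj mulrDl !mulrVK //.
by rewrite rmorphD opprD addrACA subrr addr0 rmorphM mulrBr.
Qed.

Lemma oreCV c : c != 0 -> C c * C c^-1 = 1 /\ C c^-1 * C c = 1.
Proof. by move=> /hK uc; rewrite -!rmorphM divrr // mulVr // rmorph1. Qed.

(** A witness may be replaced by its constant remainder. *)
Lemma right_linked_const a e :
  right_linked (t - C a) e <->
  exists2 c, c != 0 & lprinc (t - C a) (e * C c).
Proof.
split=> [[x nx ex]|[c cN0 ec]]; last first.
  by exists (C c) => // /lprinc_linear_const/eqP; apply/negP.
have [c xc] := lprinc_linear_rem a x; exists c.
  by apply: contra_not_neq nx => c0; rewrite c0 rmorph0 subr0 in xc.
by rewrite -[C c](subKr x) mulrBr; apply: lprincB => //; apply: lprinc_mull.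
Qed.

Lemma left_linked_const (Sinv : K -> K) (hS' : cancel Sinv S) a e :
  left_linked (t - C a) e <->
  exists2 c, c != 0 & rprinc (t - C a) (C c * e).
Proof.
split=> [[x nx ex]|[c cN0 ec]]; last first.
  by exists (C c) => // /rprinc_linear_const/eqP; apply/negP.
have [c xc] := rprinc_linear_rem hS' a x; exists c.
  by apply: contra_not_neq nx => c0; rewrite c0 rmorph0 subr0 in xc.
by rewrite -[C c](subKr x) mulrBl; apply: rprincB => //; apply: rprinc_mulr.
Qed.

Lemma linear_sdconj a c : c != 0 ->
  t - C (sdconj D a c) = C (S c) * (t - C a) * C c^-1.
Proof.
by move=> cN0; rewrite -sdconj_intertwine // -mulrA (oreCV cN0).1 mulr1.
Qed.

Lemma right_roots_sdconj a c e : c != 0 ->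
  right_roots e (sdconj D a c) <-> lprinc (t - C a) (e * C c).
Proof.
move=> cN0; have [_ VSc] := oreCV (division_rmorph_neq0 hK S cN0).
have [cV Vc] := oreCV cN0; rewrite /right_roots /= linear_sdconj //.
split=> /lprincP[h]; [move=> -> | move=> ec]; apply/lprincP.
  by exists (h * C (S c)); rewrite -!mulrA Vc mulr1.
exists (h * C (S c)^-1).
by rewrite -[LHS]mulr1 -cV mulrA ec -!mulrA (mulrA _ (C (S c))) VSc mul1r.
Qed.

(** On the left the intertwining constant shows up as the inverse of [S c], as
    it must be moved across [t - a] before it can act on [e]. *)
Lemma left_roots_sdconj a c e : c != 0 ->
  left_roots e (sdconj D a c) <-> rprinc (t - C a) (C (S c)^-1 * e).
Proof.
move=> cN0; have [ScV VSc] := oreCV (division_rmorph_neq0 hK S cN0).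
have [_ Vc] := oreCV cN0; rewrite /left_roots /= linear_sdconj //.
split=> /rprincP[h]; [move=> -> | move=> ec]; apply/rprincP.
  by exists (C c^-1 * h); rewrite !mulrA VSc mul1r.
exists (C c * h).
by rewrite -[LHS]mul1r -ScV -mulrA ec -!mulrA (mulrA _ (C c)) Vc mul1r.
Qed.

(** * Eigenvalues as torsion of t I - A *)

(** Division of the column [(t I - A) c] by [t - b] on the right; the remainder
    is the obstruction to [S c] being an eigenvector for [b]. *)
Lemma mul_char_col n (A : 'M[K]_n) b (c : 'cV[K]_n) i :
  ((t%:M - map_mx C A) *m map_mx C c) i 0 =
  C (S (c i 0)) * (t - C b)
    - C ((A *m c) i 0 - D (c i 0) - S (c i 0) * b).
Proof.
have -> : ((t%:M - map_mx C A) *m map_mx C c) i 0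
    = t * C (c i 0) - C ((A *m c) i 0).
  by rewrite mulmxBl mul_scalar_mx -map_mxM !mxE.
rewrite ore_tC mulrBr -rmorphM !rmorphB /= opprB addrA subrK.
by rewrite opprB addrA.
Qed.

(** Division of the row [S(v) (t I - A)] by [t - a] on the left. *)
Lemma mul_row_char n (A : 'M[K]_n) a (v : 'rV[K]_n) i :
  (map_mx C (map_mx S v) *m (t%:M - map_mx C A)) 0 i =
  (t - C a) * C (v 0 i) - C ((row_semilin D A v - a *: v) 0 i).
Proof.
have -> : (map_mx C (map_mx S v) *m (t%:M - map_mx C A)) 0 i
    = C (S (v 0 i)) * t - C ((map_mx S v *m A) 0 i).
  rewrite mulmxBr -map_mxM !mxE; congr (_ - _).
  rewrite (bigD1 i) //= big1 ?addr0 => [|j /negPf jNi]; rewrite !mxE ?eqxx //.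
  by rewrite jNi mulr0.
have -> : (row_semilin D A v - a *: v) 0 i
    = (map_mx S v *m A) 0 i + D (v 0 i) - a * v 0 i.
  by rewrite !mxE.
rewrite mulrBl ore_tC -rmorphM rmorphB rmorphD /= opprB addrA subrK.
by rewrite [X in _ = _ - X]addrC opprD addrA addrK.
Qed.

(** An eigenvector [S c] gives the constant column [c], and conversely a column
    over [R] killed modulo [R (t - b)] may be replaced by the column of its
    constant remainders. *)
Lemma rspecE (Sinv : K -> K) (hS : cancel S Sinv) (hS' : cancel Sinv S)
    n (A : 'M[K]_n) b :
  rspec Sinv D A b <-> col_annihilated (t - C b) (t%:M - map_mx C A).
Proof.
have SinvS u : map_mx Sinv (map_mx S u) = u :> 'cV[K]_n.
  by apply/matrixP=> i j; rewrite !mxE hS.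
have SSinv u : map_mx S (map_mx Sinv u) = u :> 'cV[K]_n.
  by apply/matrixP=> i j; rewrite !mxE hS'.
have eigenE (c : 'cV[K]_n) i :
    lprinc (t - C b) (((t%:M - map_mx C A) *m map_mx C c) i 0)
    <-> col_semilin Sinv D A (map_mx S c) i 0 = S (c i 0) * b.
  rewrite (mul_char_col A b).
  have -> : (A *m c) i 0 - D (c i 0) = col_semilin Sinv D A (map_mx S c) i 0.
    by rewrite /col_semilin SinvS !mxE.
  have pp := lprinc_gen (t - C b) (C (S (c i 0))).
  split=> [Mc|->]; last by rewrite subrr rmorph0 subr0.
  apply/subr0_eq/(@lprinc_linear_const b).
  by have := lprincB pp Mc; rewrite subKr.
split=> [[u uN0 Lu]|[w [i nwi] Mw]].
  exists (map_mx C (map_mx Sinv u)).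
    apply: contrapT => /forallNP Cu; move/eqP: uN0; apply.
    rewrite -[u]SSinv; apply/matrixP=> i j; rewrite (ord1 j) mxE [RHS]mxE.
    rewrite (@lprinc_linear_const b (map_mx Sinv u i 0)) ?raddf0 //.
    by have /contrapT := Cu i; rewrite mxE.
  by move=> i; apply/eigenE; rewrite SSinv Lu !mxE hS'.
have [c cP] := choice (fun i => lprinc_linear_rem b (w i 0)).
pose v : 'cV[K]_n := \col_i c i.
exists (map_mx S v).
  apply/eqP=> Sv0; apply: nwi; have := cP i.
  have -> : c i = 0.
    have /matrixP/(_ i 0) := Sv0; rewrite !mxE => Sc0.
    by apply: (can_inj hS); rewrite Sc0 rmorph0.
  by rewrite rmorph0 subr0.
apply/matrixP=> j k; rewrite (ord1 k) [RHS]mxE [in RHS]mxE; apply/eigenE.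
have -> : map_mx C v = w - \col_i (w i 0 - C (c i)).
  by apply/matrixP=> i' k'; rewrite (ord1 k') !mxE subKr.
set M := _ - map_mx C A; set r := \col_i _.
have -> : (M *m (w - r)) j 0 = (M *m w) j 0 - (M *m r) j 0.
  by rewrite mulmxBr !mxE.
by apply/(lprincB (Mw j))/lprinc_mulmx => i'; rewrite mxE.
Qed.

Lemma lspecE (Sinv : K -> K) (hS : cancel S Sinv) (hS' : cancel Sinv S)
    n (A : 'M[K]_n) a :
  lspec D A a <-> row_annihilated (t - C a) (t%:M - map_mx C A).
Proof.
have eigenE (v : 'rV[K]_n) i :
    rprinc (t - C a) ((map_mx C (map_mx S v) *m (t%:M - map_mx C A)) 0 i)
    <-> (row_semilin D A v - a *: v) 0 i = 0.
  rewrite (mul_row_char A a).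
  have pp := rprinc_gen (t - C a) (C (v 0 i)).
  split=> [Mv|->]; last by rewrite rmorph0 subr0.
  apply/(@rprinc_linear_const a).
  by have := rprincB pp Mv; rewrite subKr.
split=> [[v vN0 Tv]|[w [i nwi] wM]].
  exists (map_mx C (map_mx S v)).
    apply: contrapT => /forallNP Cv; move/eqP: vN0; apply.
    apply/matrixP=> j i; rewrite (ord1 j) [RHS]mxE.
    apply: (can_inj hS); rewrite rmorph0; apply: (@rprinc_linear_const a).
    by have /contrapT := Cv i; rewrite !mxE.
  by move=> i; apply/eigenE; rewrite Tv subrr mxE.
have [c cP] := choice (fun i => rprinc_linear_rem hS' a (w 0 i)).
pose v : 'rV[K]_n := \row_i Sinv (c i).
exists v.
  apply/eqP=> v0; apply: nwi; have := cP i.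
  have -> : c i = 0.
    have /matrixP/(_ 0 i) := v0; rewrite !mxE -{2}[c i]hS' => ->.
    by rewrite rmorph0.
  by rewrite rmorph0 subr0.
apply/subr0_eq/matrixP=> k j; rewrite (ord1 k) [RHS]mxE; apply/eigenE.
have -> : map_mx C (map_mx S v) = w - \row_i (w 0 i - C (c i)).
  by apply/matrixP=> k' i'; rewrite (ord1 k') !mxE hS' subKr.
set M := _ - map_mx C A; set r := \row_i _.
have -> : ((w - r) *m M) 0 j = (w *m M) 0 j - (r *m M) 0 j.
  by rewrite mulmxBl !mxE.
by apply/(rprincB (wM j))/rprinc_mulmx => i'; rewrite mxE.
Qed.

End LinearFactor.

(** * The equivalences *)

(* The default 1 of last is never used when n > 0: there is then at least one
   invariant factor. *)
Theorem proposition6p6 (K : unitRingType) (hK : division_ring K)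
  (S : {rmorphism K -> K}) (Sinv : K -> K)
  (hS : cancel S Sinv) (hS' : cancel Sinv S) (D : skew_derivation S)
  (n : nat) (A : 'M[K]_n) (es : seq (ore D))
  (hes : invariant_factors D A es) :
  let er := last 1 es in
  (forall beta : K,
    [<-> rspec Sinv D A beta;
         exists2 gamma : K, gamma != 0 & right_roots er (sdconj D beta gamma);
         exists2 er' : ore D, simclass er er' & right_roots er' beta]) /\
  (forall alpha : K,
    [<-> lspec D A alpha;
         exists2 gamma : K, gamma != 0 & left_roots er (sdconj D alpha gamma);
         exists2 er' : ore D, simclass er er' & left_roots er' alpha]).
Proof.
case: hes => P [Q [d [vP vQ PMQ sd ->]]] er.
have dom := ore_no_zero_divisors hK (D := D).
have pN1 a : ~ lprinc (oreT D - oreC D a) 1.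
  rewrite -(rmorph1 (oreC D)) => /(lprinc_linear_const hK)/eqP.
  by rewrite oner_eq0.
have pN1' a : ~ rprinc (oreT D - oreC D a) 1.
  rewrite -(rmorph1 (oreC D)) => /(rprinc_linear_const hK)/eqP.
  by rewrite oner_eq0.
split=> a.
  have rspec_linked : rspec Sinv D A a <-> right_linked (oreT D - oreC D a) er.
    rewrite (rspecE hK D hS hS') (col_annihilated_equiv _ vP vQ PMQ).
    by rewrite col_annihilated_diag right_linked_last.
  tfae.
  - case/rspec_linked/(right_linked_const hK) => c cN0 ec.
    by exists c => //; apply/right_roots_sdconj.
  - case=> c cN0 /(right_roots_sdconj hK _ _ cN0) ec.
    exists (er * oreC D c) => //; have [cV Vc] := oreCV hK D cN0.
    apply: (similar_mulr Vc cV) => x /lprincP[h ->].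
      by apply/lprincP; exists h; rewrite -!mulrA cV mulr1.
    by apply/lprincP; exists h; rewrite mulrA.
  - case=> e' sim_e' pe'; apply/rspec_linked.
    exact: similar_right_linked sim_e' pe'.
have lspec_linked : lspec D A a <-> left_linked (oreT D - oreC D a) er.
  rewrite (lspecE hK D hS hS') (row_annihilated_equiv _ vP vQ PMQ).
  by rewrite row_annihilated_diag left_linked_last.
tfae.
- case/lspec_linked/(left_linked_const hK hS') => c cN0 ce.
  have cVN0 : Sinv c^-1 != 0.
    apply: contraNneq cN0 => c0.
    by rewrite -[c]invrK -[c^-1]hS' c0 rmorph0 invr0.
  (* With gamma = S^-1(c^-1) the constant (S gamma)^-1 becomes c. *)
  exists (Sinv c^-1) => //; apply/left_roots_sdconj => //.
  by rewrite hS' invrK.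
- case=> c cN0 /(left_roots_sdconj hK _ _ cN0) ce.
  exists (oreC D (S c)^-1 * er) => //.
  have [cV Vc] := oreCV hK D (division_rmorph_neq0 hK S cN0).
  (* The left ideals generated by a e and by e coincide for a unit a. *)
  apply: (similar_mulr (mulr1 1) (mulr1 1)) => x; rewrite mulr1 => /lprincP[h ->].
    by apply/lprincP; exists (h * oreC D (S c)^-1); rewrite mulrA.
  apply/lprincP; exists (h * oreC D (S c)).
  by rewrite -mulrA (mulrA _ _ er) cV mul1r.
- case=> e' sim_e' pe'; apply/lspec_linked.
  apply: similar_left_linked sim_e' pe' => //; exact/eqP/linear_neq0.
Qed.
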